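(* Let $\mathcal{G}$ be an ADMG. Let $\mathcal{X},\mathcal{Y},\mathcal{Z}$ be pairwise disjoint subsets of nodes of $\mathcal{G}$. The following properties are equivalent: 1. $\mathcal{X}$ and $\mathcal{Y}$ are not d-separated by $\mathcal{Z}$ in $\mathcal{G}$. 2. $\mathcal{G}$ contains a structure of interest $\sigma$ that connects $\mathcal{X}$ and $\mathcal{Y}$ under $\mathcal{Z}$.
   Context: A mixed graph is a finite graph with directed edges ($\rightarrow$) and bidirected edges ($\leftrightarrow$); a directed and a bidirected edge may both be present between the same two vertices. An ADMG (acyclic directed mixed graph) is a mixed graph without directed cycles, all of whose edges join distinct vertices. d-separation: A path is a sequence of distinct vertices joined by consecutive edges. An interior vertex of a path is a collider on it if both adjacent path edges have an arrowhead at it; all other vertices of the path are non-colliders. A vertex $V$ on a path is active relative to $\mathcal{Z}$ if either $V$ is a collider and $V$ or one of its descendants is in $\mathcal{Z}$, or $V$ is a non-collider and $V\notin\mathcal{Z}$. A path is active given $\mathcal{Z}$ if each of its vertices is active relative to $\mathcal{Z}$. $\mathcal{X}$ and $\mathcal{Y}$ are d-separated by $\mathcal{Z}$ if no path between a vertex of $\mathcal{X}$ and a vertex of $\mathcal{Y}$ is active given $\mathcal{Z}$. Structure of interest: an ADMG with a single connected component in which each node $V$ satisfies: $V$ has at most one outgoing arrow (directed edge with tail at $V$), or $V$ has two outgoing arrows but no incoming arrow (no directed or bidirected edge with an arrowhead at $V$). Roots: $\mathrm{Root}(\mathcal{G})$ is the set of vertices of $\mathcal{G}$ that have no child in $\mathcal{G}$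 (no outgoing directed edge). A structure of interest $\sigma$ connects $\mathcal{X}$ and $\mathcal{Y}$ under $\mathcal{Z}$ in a mixed graph $\mathcal{G}$ if: (i) $\sigma\subseteq\mathcal{G}$ (subgraph); (ii) $\sigma$ contains a vertex of $\mathcal{X}$ and a vertex of $\mathcal{Y}$; (iii) $\mathrm{Root}(\sigma)\subseteq\mathcal{Z}\cup\mathcal{X}\cup\mathcal{Y}$; (iv) no vertex of $\sigma$ outside $\mathrm{Root}(\sigma)$ belongs to $\mathcal{Z}$. *)

(* Defs.v *)
From mathcomp Require Import all_boot.

Set Implicit Arguments.
Unset Strict Implicit.
Unset Printing Implicit Defensive.

(* The vertex set is explicit, inside an ambient finite type, so that a graph
   and its subgraphs have the same type. *)
Record mixed_graph (T : finType) := MixedGraph {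
  vert : {set T};
  dir : rel T;
  bid : rel T;
  dir_vert : forall u v, dir u v -> (u \in vert) && (v \in vert);
  bid_vert : forall u v, bid u v -> (u \in vert) && (v \in vert);
  bid_sym : symmetric bid
}.

Definition admg (T : finType) (g : mixed_graph T) : Prop :=
  [/\ forall c : seq T, cycle (dir g) c -> c = [::],
      irreflexive (dir g) & irreflexive (bid g)].

Definition subgraph (T : finType) (s g : mixed_graph T) : Prop :=
  [/\ vert s \subset vert g, subrel (dir s) (dir g) & subrel (bid s) (bid g)].

(* An edge traversed from u to v: u -> v, u <- v or u <-> v. *)
Inductive edge_kind := Forward | Backward | Bidirected.

Definition joins (T : finType) (g : mixed_graph T) (k : edge_kind) (u v : T) :=
  match k with
  | Forward => dir g u v
  | Backward => dir g v u
  | Bidirected => bid g u v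
  end.

Definition head_at_source (k : edge_kind) : bool :=
  if k is Forward then false else true.
Definition head_at_target (k : edge_kind) : bool :=
  if k is Backward then false else true.

(* A walk from x is the list of its (edge, next vertex) steps: since a directed
   and a bidirected edge may join the same two vertices, the vertices alone do
   not determine the edges used. *)
Fixpoint walk (T : finType) (g : mixed_graph T) (x : T)
    (p : seq (edge_kind * T)) : bool :=
  if p is (k, y) :: p' then joins g k x y && walk g y p' else true.

Definition vertices (T : finType) (x : T) (p : seq (edge_kind * T)) : seq T :=
  x :: unzip2 p.

Definition is_path (T : finType) (g : mixed_graph T) (x : T)
    (p : seq (edge_kind * T)) : bool :=
  [&& x \in vert g, walk g x p & uniq (vertices x p)].

(* Edge number i goes from vertex number i to vertex number i.+1 (both counted
   from 0), so the path edges at an interior vertex i are i.-1 and i. *)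
Definition collider (T : finType) (p : seq (edge_kind * T)) (i : nat) : bool :=
  [&& 0 < i < size p,
      head_at_target (nth Forward (unzip1 p) i.-1)
    & head_at_source (nth Forward (unzip1 p) i)].

(* [connect] is reflexive, hence covers a collider that is itself in Z. *)
Definition active_vertex (T : finType) (g : mixed_graph T) (Z : {set T})
    (x : T) (p : seq (edge_kind * T)) (i : nat) : bool :=
  let v := nth x (vertices x p) i in
  if collider p i then [exists w in Z, connect (dir g) v w] else v \notin Z.

Definition active_path (T : finType) (g : mixed_graph T) (Z : {set T})
    (x : T) (p : seq (edge_kind * T)) : Prop :=
  forall i, i < size (vertices x p) -> active_vertex g Z x p i.

Definition d_separated (T : finType) (g : mixed_graph T) (X Y Z : {set T}) :
    Prop :=
  forall (x : T) (p : seq (edge_kind * T)),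
    x \in X -> last x (unzip2 p) \in Y -> is_path g x p ->
    ~ active_path g Z x p.

Definition adjacent (T : finType) (g : mixed_graph T) : rel T :=
  fun u v => [|| dir g u v, dir g v u | bid g u v].

Definition children (T : finType) (g : mixed_graph T) (v : T) : {set T} :=
  [set w | dir g v w].

Definition structure_of_interest (T : finType) (s : mixed_graph T) : Prop :=
  [/\ admg s,
      n_comp (adjacent s) (vert s) = 1
    & forall v, v \in vert s ->
        #|children s v| <= 1 \/
        (#|children s v| = 2 /\ forall u, ~~ dir s u v /\ ~~ bid s u v)].

Definition Root (T : finType) (g : mixed_graph T) : {set T} :=
  [set v in vert g | children g v == set0].

Definition connects_under (T : finType) (s g : mixed_graph T)
    (X Y Z : {set T}) : Prop :=
  [/\ subgraph s g,
      (exists2 x, x \in vert s & x \in X) /\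
      (exists2 y, y \in vert s & y \in Y),
      Root s \subset Z :|: X :|: Y
    & forall v, v \in vert s -> v \notin Root s -> v \notin Z].

(* Main.v *)
Require Import Defs.
From mathcomp Require Import all_boot.
From Stdlib Require Import Classical.

Set Implicit Arguments.
Unset Strict Implicit.
Unset Printing Implicit Defensive.

(** Both directions rest on choosing a good subgraph, so that no path has to be
repaired step by step.

From an active path to a structure: let S be the union of X, Y and Z. Keep the
ancestors of S in G, and delete the arrows leaving Z. In this graph
([ancestral]) every vertex outside S still has a child, so its roots lie in S,
and its non-roots avoid Z. It contains every active path from X to Y: following
the arrows from a vertex of the path leads, along the path, to a collider, which
is an ancestor of Z, or to an end of the path, which lies in X or Y; and an
arrow of the path leaving a vertex makes this vertex a non-collider, hence
outside Z ([active_connect]). So there is a subgraph that satisfies the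
conditions on roots and joins X to Y, and we take one with fewest vertices and
edges. Deleting vertices and edges preserves the conditions on roots as long as
no remaining vertex loses all its children ([trims]), hence no such deletion
can keep X joined to Y. This forces the local shape ([irreducible_fork]).
Suppose that v has two children. From x in X, approach v by a route that meets v
only at its end, with a the vertex just before v; let b be likewise for y in Y.
If w is a child other than a and b, both routes survive the deletion of v -> w;
so the children of v are a and b. Suppose that some edge from u has an
arrowhead at v. Deleting all but v and the two parts reachable from x or from y
without v keeps the routes, and every remaining vertex keeps a child: v keeps
a, and a child of any other remaining vertex remains. So u is in one of the
parts, say that of x; then the route from x can enter v through u, and v -> a
can be deleted, a contradiction.

From a structure to an active path: every vertex of a connecting structure s is an
ancestor, in s, of a root, hence of X, Y or Z. Call A and B the ancestors of X
and of Y. A shortest path in s from A to B meets A only at its first vertex and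
B only at its last, so its interior vertices are ancestors of Z and its
colliders are harmless. Continue it at both ends by directed paths to X and to
Y; these run inside A and inside B, so they avoid its interior. They also avoid
each other: this is clear if A and B are disjoint; otherwise start from a vertex
in both that has no proper descendant in both, with an empty middle part
([bridge_choice]). On the resulting path every non-collider is an end in X or Y,
or has a child in s; so it is not in Z. *)

(** * Active paths, read from the source *)

Definition ancestors (T : finType) (g : mixed_graph T) (S : {set T}) : {set T} :=
  [set v | [exists w in S, connect (dir g) v w]].

(** Activity as a recursion on the walk, which avoids indices: [b] tells whether
    the step that enters [x] has an arrowhead at [x]. A source has [b = false],
    because it is never a collider. *)
Fixpoint active_from (T : finType) (g : mixed_graph T) (Z : {set T}) (b : bool)
    (x : T) (p : seq (edge_kind * T)) : bool :=
  if p is (k, y) :: p' then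
    (if b && head_at_source k then x \in ancestors g Z else x \notin Z)
    && active_from g Z (head_at_target k) y p'
  else x \notin Z.

Lemma ancestorsP (T : finType) (g : mixed_graph T) (S : {set T}) v :
  reflect (exists2 w, w \in S & connect (dir g) v w) (v \in ancestors g S).
Proof. by rewrite inE; apply: exists_inP. Qed.

Lemma mem_ancestors (T : finType) (g : mixed_graph T) (S : {set T}) v :
  v \in S -> v \in ancestors g S.
Proof. by move=> vS; apply/ancestorsP; exists v. Qed.

Lemma ancestors_connect (T : finType) (g : mixed_graph T) (S : {set T}) u v :
  connect (dir g) u v -> v \in ancestors g S -> u \in ancestors g S.
Proof.
move=> uv /ancestorsP[w wS vw]; apply/ancestorsP; exists w => //.
exact: connect_trans vw.
Qed.

Lemma active_from_notin (T : finType) (g : mixed_graph T) (Z : {set T}) x p :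
  active_from g Z false x p -> x \notin Z.
Proof. by case: p => [|[k y] p] //= /andP[]. Qed.

Definition entering (b : bool) (T : finType) (p : seq (edge_kind * T)) i :=
  if i is j.+1 then head_at_target (nth Forward (unzip1 p) j) else b.

(** The position-wise definition, generalised to an arbitrary entering mark [b]
    and default vertex [d] so that induction on the walk goes through. *)
Lemma active_fromP (T : finType) (g : mixed_graph T) (Z : {set T}) d b x p :
  (forall i, i < (size p).+1 ->
     let v := nth d (vertices x p) i in
     if [&& i < size p, entering b p i
          & head_at_source (nth Forward (unzip1 p) i)]
     then v \in ancestors g Z else v \notin Z)
  <-> active_from g Z b x p.
Proof.
elim: p b x => [|[k y] p IHp] b x /=.
  by split=> [/(_ 0)|xZ [|i]] //; apply.
split=> [act|/andP[actx actp] [|i] ltip //=].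
  apply/andP; split; first by have := act 0 isT.
  by apply/IHp => -[|i] ltip; [have := act 1 isT | have := act i.+2 ltip].
by have /IHp/(_ i ltip) := actp; case: i ltip.
Qed.

Lemma active_pathP (T : finType) (g : mixed_graph T) (Z : {set T}) x p :
  active_path g Z x p <-> active_from g Z false x p.
Proof.
rewrite -(active_fromP g Z x).
have colE i : collider p i = [&& i < size p, entering false p i
          & head_at_source (nth Forward (unzip1 p) i)].
  by case: i => [|i]; rewrite /collider ?andbF.
by split=> act i; move/(_ i): act; rewrite /= /active_vertex /vertices colE /=
  size_map !inE.
Qed.

(** * Connectivity in finite relations *)

Definition avoiding (T : finType) (v : T) (e : rel T) : rel T :=
  [rel u w | [&& e u w, u != v & w != v]].

(** Stop a path at its first visit to [v]: [a] is the vertex just before. The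
    degenerate case [a = v] stands for a path that starts at [v]. *)
Lemma connect_last_step (T : finType) (e : rel T) x v : connect e x v ->
  exists a, (a = v /\ x = v) \/ [/\ e a v, a != v & connect (avoiding v e) x a].
Proof.
case/connectP=> p; elim: p x => [|y p IHp] x /=; first by exists v; left.
case/andP=> xy /IHp{}IHp /IHp[a IHa].
have [->|xv] := eqVneq x v; first by exists v; left.
have [yv|ynv] := eqVneq y v.
  by exists x; right; rewrite -{1}yv; split.
case: IHa => [[_ yv]|[av anv ya]]; first by rewrite yv eqxx in ynv.
exists a; right; split=> //; apply: connect_trans ya; apply: connect1.
by apply/and3P; split.
Qed.

Lemma connect_within (T : finType) (e e' : rel T) x a :
    (forall u w, connect e x u -> connect e x w -> e u w -> e' u w) ->
  connect e x a -> connect e' x a.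
Proof.
move=> sub /connectP[p]; elim/last_ind: p a => [|p z IHp] a /=.
  by move=> _ ->.
rewrite rcons_path last_rcons => /andP[xp ez] ->.
have cl : connect e x (last x p) by apply/connectP; exists p.
apply: connect_trans (IHp _ xp erefl) _; apply: connect1; apply: sub => //.
by apply: connect_trans cl (connect1 ez).
Qed.

(** Take a shortest path from A to B: a further visit to A or to B would allow
    to cut it. *)
Lemma connect_between (T : finType) (e : rel T) (A B : {set T}) x y :
    connect e x y -> x \in A -> y \in B ->
  exists a p, [/\ path e a p, uniq (a :: p), a \in A, last a p \in B
    & {in a :: p, forall w, (w \in A -> w = a) /\ (w \in B -> w = last a p)}].
Proof.
case/connectP=> p; have [n] := ubnP (size p).
elim: n => // n IHn in x y p *; rewrite ltnS => lepn xp -> xA yB {y}.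
case/shortenP: xp yB => q xq uq sqp yB.
have leqn : size q <= n.
  by apply: leq_trans lepn; case/andP: uq => _ /uniq_leq_size; apply.
have [/hasP[w wq wA]|/hasPn noA] := boolP (has (mem A) q).
  case/splitPr: wq xq leqn yB => q1 q2.
  rewrite cat_path last_cat size_cat /= => /and3P[_ _ wq2] leqn.
  apply: IHn wq2 erefl wA; apply: leq_trans leqn.
  by rewrite addnS ltnS leq_addl.
have [/hasP[w wq /andP[wB nwl]]|/hasPn noB] :=
    boolP (has (fun w => (w \in B) && (w != last x q)) (x :: q)).
  case/splitPl: wq xq leqn nwl => q1 [|z q2] lq1.
    by rewrite cats0 lq1 eqxx.
  rewrite size_cat cat_path => /andP[xq1 _] leqn _; apply: IHn xq1 (esym lq1) xA wB.
  by apply: leq_trans leqn; rewrite /= addnS ltnS leq_addr.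
exists x, q; split=> // w wq; split=> [wA|wB].
  by case/predU1P: wq => // /noA; rewrite /= wA.
by apply/eqP; have := noB w wq; rewrite wB negbK.
Qed.

(** * Walks and directed paths *)

Lemma walk_cat (T : finType) (g : mixed_graph T) x p q :
  walk g x (p ++ q) = walk g x p && walk g (last x (unzip2 p)) q.
Proof. by elim: p x => [|[k y] p IHp] x //=; rewrite IHp andbA. Qed.

Lemma walk_sub (T : finType) (s g : mixed_graph T) x p :
  subgraph s g -> walk s x p -> walk g x p.
Proof.
case=> _ sd sb; elim: p x => [|[k y] p IHp] x //= /andP[xy /IHp->].
by rewrite andbT; case: k xy => /=; auto.
Qed.

Lemma adjacent_walk (T : finType) (g : mixed_graph T) x p :
  path (adjacent g) x p -> exists2 m, unzip2 m = p & walk g x m.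
Proof.
elim: p x => [|y p IHp] x /=; first by exists [::].
case/andP=> xy /IHp[m <- wm].
have [k kxy] : exists k, joins g k x y.
  by case/or3P: xy; [exists Forward | exists Backward | exists Bidirected].
by exists ((k, y) :: m) => //=; rewrite kxy.
Qed.

Definition label_steps (T : finType) (k : edge_kind) (p : seq T) :=
  [seq (k, y) | y <- p].

Lemma unzip2_label_steps (T : finType) k (p : seq T) : unzip2 (label_steps k p) = p.
Proof. by rewrite /unzip2 -map_comp map_id. Qed.

Lemma walk_label_steps (T : finType) (g : mixed_graph T) k x p :
  walk g x (label_steps k p) = path (joins g k) x p.
Proof. by elim: p x => //= y p IHp x; rewrite IHp. Qed.

(** Only the colliders are constrained: inside a structure the non-colliders
    take care of themselves. [b] is the mark of the entering step, as in
    [active_from]. *)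
Fixpoint colliders_in (T : finType) (S : {set T}) (b : bool) (x : T)
    (p : seq (edge_kind * T)) : bool :=
  if p is (k, y) :: p' then
    (b && head_at_source k ==> (x \in S))
    && colliders_in S (head_at_target k) y p'
  else true.

Lemma colliders_in_backward (T : finType) (S : {set T}) x q p :
  colliders_in S false x (label_steps Backward q ++ p)
  = colliders_in S false (last x q) p.
Proof. by elim: q x => //= y q IHq x. Qed.

Lemma colliders_in_forward (T : finType) (S : {set T}) b x q :
  colliders_in S b x (label_steps Forward q).
Proof. by elim: q b x => //= y q IHq b x; rewrite andbF IHq. Qed.

(** The last vertex of [m] is exempt because it is left by an arrow or ends the
    walk, so it is not a collider. *)
Lemma colliders_in_middle (T : finType) (S : {set T}) (b : bool) x m q :
    uniq (vertices x m) -> (b -> x = last x (unzip2 m) \/ x \in S) ->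
    {in unzip2 m, forall w, w = last x (unzip2 m) \/ w \in S} ->
  colliders_in S b x (m ++ label_steps Forward q).
Proof.
elim: m b x => [|[k y] m IHm] b x /=; first by rewrite colliders_in_forward.
rewrite /vertices /= => /andP[xym um] bx Sm; apply/andP; split.
  apply/implyP=> /andP[/bx[xl|//] _].
  by rewrite {1}xl mem_last in xym.
apply: IHm => // [_|w wm]; first by apply: Sm; rewrite mem_head.
by apply: Sm; rewrite inE wm orbT.
Qed.

(** An interior non-collider is the tail of one of the two steps at it; that
    step is an arrow of [s], which keeps it out of Z. *)
Lemma active_from_colliders (T : finType) (s g : mixed_graph T)
    (Z : {set T}) (b : bool) x p :
    subgraph s g -> (forall u v, dir s u v -> u \notin Z) ->
    walk s x p -> (~~ b -> x \notin Z) -> last x (unzip2 p) \notin Z ->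
    colliders_in (ancestors s Z) b x p ->
  active_from g Z b x p.
Proof.
case=> _ sd _ tailZ; elim: p b x => [|[k y] p IHp] b x //=.
case/andP=> xy wp xZ lZ /andP[xS cp]; apply/andP; split; last first.
  by apply: IHp => //; case: k xy {xS cp} => //= yx _; apply: tailZ yx.
case: ifP xS => /= [_ /ancestorsP[w wZ xw]|nc _].
  by apply/ancestorsP; exists w => //; apply: connect_sub xw => u v /sd/connect1.
by case: k nc xy {cp} => [_ /tailZ //|/negbT|/negbT]; rewrite andbT => /xZ.
Qed.

Lemma directed_path (T : finType) (g : mixed_graph T) (S : {set T}) v :
    v \in ancestors g S ->
  exists p, [/\ path (dir g) v p, uniq (v :: p) & last v p \in S].
Proof.
case/ancestorsP=> w wS /connectP[p vp lp]; move: wS; rewrite lp.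
by case/shortenP: vp => q vq uq _ lS; exists q.
Qed.

Lemma mem_directed_path (T : finType) (g : mixed_graph T) (S : {set T}) v p :
    path (dir g) v p -> last v p \in S ->
  {in v :: p, forall w, connect (dir g) v w /\ w \in ancestors g S}.
Proof.
move=> vp lS w wp; split; first exact: path_connect vp _ wp.
case/splitPl: wp vp lS => p1 p2 lp1.
rewrite cat_path last_cat lp1 => /andP[_ wp2] lS.
by apply/ancestorsP; exists (last w p2) => //; apply/connectP; exists p2.
Qed.

(** * Acyclicity *)

Lemma acyclic_dir (T : finType) (g : mixed_graph T) v w :
  admg g -> dir g v w -> ~~ connect (dir g) w v.
Proof.
case=> acyc _ _ vw; apply/negP=> /connectP[p wp lp].
by have /acyc : cycle (dir g) (w :: p) by rewrite /= rcons_path wp -lp.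
Qed.

Lemma acyclic_connect (T : finType) (g : mixed_graph T) v w :
  admg g -> connect (dir g) v w -> connect (dir g) w v -> v = w.
Proof.
move=> ag /connectP[[|u p]] /=; first by move=> _ ->.
case/andP=> vu up lp wv; case/negP: (acyclic_dir ag vu).
by apply: connect_trans wv; apply/connectP; exists p.
Qed.

(** Among the descendants of [v] in [P], one with fewest descendants: by
    acyclicity a proper descendant has strictly fewer. *)
Lemma acyclic_minimal (T : finType) (g : mixed_graph T) (P : {set T}) v :
    admg g -> v \in P ->
  exists u, [/\ u \in P, connect (dir g) v u
    & {in P, forall w, connect (dir g) u w -> w = u}].
Proof.
move=> ag vP.
pose Q := [pred u | (u \in P) && connect (dir g) v u].
have vQ : Q v by rewrite /= vP connect0.
case: (@arg_minnP _ v Q (fun u => #|connect (dir g) u|) vQ) => u /andP[uP vu] minu.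
exists u; split=> // w wP uw; apply/eqP/negPn/negP=> wu.
have := minu w; rewrite /= wP (connect_trans vu uw) => /(_ isT); apply/negP.
rewrite -ltnNge; apply/proper_card/properP; split.
  by apply/subsetP=> z; rewrite !inE => /(connect_trans uw).
exists u; rewrite !inE ?connect0 //; apply: contra wu => wu.
by rewrite (acyclic_connect ag uw wu).
Qed.

Lemma ancestors_Root (T : finType) (g : mixed_graph T) v :
  admg g -> v \in vert g -> v \in ancestors g (Root g).
Proof.
move=> ag vg; have [u [ug vu minu]] := acyclic_minimal ag vg.
apply/ancestorsP; exists u => //; rewrite inE ug; apply/eqP/setP=> w.
rewrite !inE; apply/negP=> uw; have /andP[_ wg] := dir_vert uw.
have wu := minu w wg (connect1 uw); move: uw; rewrite wu.
by case: ag => _ ->.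
Qed.

(** * From a connecting structure to an active path *)

Lemma adjacent_sym (T : finType) (g : mixed_graph T) : symmetric (adjacent g).
Proof. by move=> u v; rewrite /adjacent bid_sym orbCA. Qed.

Lemma adjacent_vert (T : finType) (g : mixed_graph T) u v :
  adjacent g u v -> (u \in vert g) && (v \in vert g).
Proof. by case/or3P=> [/dir_vert|/dir_vert|/bid_vert] //; rewrite andbC. Qed.

Lemma path_vert (T : finType) (g : mixed_graph T) x p :
  path (adjacent g) x p -> {subset p <= vert g}.
Proof.
elim: p x => //= y p IHp x /andP[/adjacent_vert/andP[_ yg] /IHp pg] w.
by case/predU1P=> [->|/pg].
Qed.

Lemma adjacent_closed (T : finType) (g : mixed_graph T) :
  closed (adjacent g) (vert g).
Proof. by move=> u v /adjacent_vert/andP[-> ->]. Qed.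

Lemma connect_adjacent_sym (T : finType) (g : mixed_graph T) :
  connect_sym (adjacent g).
Proof. exact: sym_connect_sym (@adjacent_sym T g). Qed.

Lemma n_comp1_connect (T : finType) (g : mixed_graph T) x y :
    n_comp (adjacent g) (vert g) = 1 -> x \in vert g -> y \in vert g ->
  connect (adjacent g) x y.
Proof.
have sg := connect_adjacent_sym g.
have rt z : z \in vert g -> root (adjacent g) z \in
    [predI roots (adjacent g) & vert g].
  move=> zg; apply/andP; split; first exact: (roots_root sg).
  by rewrite -(closed_connect (@adjacent_closed T g) (connect_root _ z)).
move=> n1 xg yg; rewrite -(root_connect sg).
have /card_le1P le1 : #|[predI roots (adjacent g) & vert g]| <= 1.
  by rewrite -[X in X <= _]/(n_comp (adjacent g) (vert g)) n1.
by have := le1 _ (rt y yg) (root (adjacent g) x); rewrite rt // => /esym.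
Qed.

Lemma nonroot_notin (T : finType) (s : mixed_graph T) (Z : {set T}) :
    (forall v, v \in vert s -> v \notin Root s -> v \notin Z) ->
  forall u v, dir s u v -> u \notin Z.
Proof.
move=> nonroot u v uv; have /andP[us _] := dir_vert uv.
apply: nonroot => //; rewrite inE us; apply/eqP=> /setP/(_ v).
by rewrite !inE uv.
Qed.

(** The last clause makes a directed path from [a] to X disjoint from one to Y
    that starts at the other end. It is vacuous when no vertex is an ancestor of
    both X and Y; otherwise the path [p] can be empty and [a] minimal. *)
Lemma bridge_choice (T : finType) (s : mixed_graph T) (X Y : {set T}) x y :
    admg s -> connect (adjacent s) x y -> x \in X -> y \in Y ->
  exists a p,
    [/\ path (adjacent s) a p, uniq (a :: p), a \in ancestors s X,
        last a p \in ancestors s Y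
      & {in a :: p, forall w, (w \in ancestors s X -> w = a) /\
                              (w \in ancestors s Y -> w = last a p)}]
    /\ {in ancestors s X :&: ancestors s Y,
          forall w, connect (dir s) a w -> w = a}.
Proof.
move=> ag xy xX yY; set A := ancestors s X; set B := ancestors s Y.
have [AB0|[v vAB]] := set_0Vmem (A :&: B).
  have [a [p Hp]] := connect_between xy (mem_ancestors s xX) (mem_ancestors s yY).
  by exists a, p; split=> // w; rewrite AB0 inE.
have [u [/setIP[uA uB] _ minu]] := acyclic_minimal ag vAB.
exists u, [::]; split=> //; split=> // w; rewrite inE => /eqP -> //.
Qed.

(** The bridge is extended by directed paths to X and to Y. They stay among the
    ancestors of X and of Y, which the bridge meets only at its ends, so no vertex
    is repeated; and the ends of the bridge, left by an arrow, are no colliders. *)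
Lemma active_path_of_structure (T : finType) (s G : mixed_graph T)
    (X Y Z : {set T}) x y :
    admg s -> subgraph s G -> [disjoint X & Z] -> [disjoint Y & Z] ->
    Root s \subset Z :|: X :|: Y ->
    (forall u v, dir s u v -> u \notin Z) ->
    x \in X -> y \in Y -> connect (adjacent s) x y ->
  exists x0 p, [/\ x0 \in X, last x0 (unzip2 p) \in Y,
    uniq (vertices x0 p), walk s x0 p & active_from G Z false x0 p].
Proof.
move=> ag sG XZ YZ rootS tailZ xX yY xy.
have anc v : v \in vert s -> [|| v \in ancestors s Z, v \in ancestors s X
                                | v \in ancestors s Y].
  move=> vs; have /ancestorsP[r rR vr] := ancestors_Root ag vs.
  have rS : [|| r \in Z, r \in X | r \in Y].
    by have := subsetP rootS r rR; rewrite !in_setU -orbA.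
  by case/or3P: rS => rS; apply/or3P; [constructor 1|constructor 2|constructor 3];
    apply/ancestorsP; exists r.
have [a [p [[ap up aA bB onlyp] onlya]]] := bridge_choice ag xy xX yY.
have [q [aq uq lqX]] := directed_path aA.
have [r [br ur lrY]] := directed_path bB.
have memq := mem_directed_path aq lqX; have memr := mem_directed_path br lrY.
have [m mp wm] := adjacent_walk ap.
have tl (z v : T) l : z \in l -> z \in v :: l by rewrite inE => ->; rewrite orbT.
pose t := label_steps Backward (rev (belast a q)) ++ m ++ label_steps Forward r.
have lrev : last (last a q) (rev (belast a q)) = a.
  by case: (q) => //= z q'; rewrite rev_cons last_rcons.
have vt : vertices (last a q) t = rev (a :: q) ++ p ++ r.
  rewrite /vertices /t /unzip2 !map_cat -!/(unzip2 _) !unzip2_label_steps mp.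
  by rewrite (lastI a q) rev_rcons.
have lt : last (last a q) (unzip2 t) = last (last a p) r.
  rewrite /t /unzip2 !map_cat -!/(unzip2 _) !unzip2_label_steps mp.
  by rewrite !last_cat lrev.
have wt : walk s (last a q) t.
  by rewrite /t !walk_cat !walk_label_steps !unzip2_label_steps lrev mp rev_path
    aq wm br.
exists (last a q), t; split=> //; first by rewrite lt.
  rewrite vt cat_uniq rev_uniq uq.
  have /andP[ap' up'] : (a \notin p) && uniq p := up.
  have /andP[br' ur'] : (last a p \notin r) && uniq r := ur.
  rewrite cat_uniq up' ur' andbT /=; apply/andP; split; last first.
    apply/hasPn=> w wr; apply: contra br' => wp.
    have [_ wB] := memr w (tl _ _ _ wr).
    have [_ /(_ wB) <- //] := onlyp w (tl _ _ _ wp).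
  apply/hasPn=> w; rewrite mem_rev mem_cat => wpr; apply/negP=> wq.
  have [aw wA] := memq w wq.
  case/orP: wpr => [wp|wr].
    have [/(_ wA) wa _] := onlyp w (tl _ _ _ wp).
    by rewrite -wa wp in ap'.
  have [_ wB] := memr w (tl _ _ _ wr).
  have wa : w = a by apply: onlya => //; rewrite inE wA.
  have [_ alast] := onlyp a (mem_head a p).
  by rewrite -alast -?wa ?wr in br'.
apply: (active_from_colliders sG tailZ wt) => [_||].
- by rewrite (disjointFr XZ).
- by rewrite lt (disjointFr YZ).
rewrite /t colliders_in_backward lrev; apply: colliders_in_middle => //.
  by rewrite /vertices mp.
rewrite mp => w wp; have [wA wB] := onlyp w (tl _ _ _ wp).
have ws := path_vert ap wp.
case/or3P: (anc w ws) => [wZ|/wA wa|/wB wb]; [by right| |by left].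
by case/andP: up; rewrite -wa wp.
Qed.

(** * Pruning *)

Definition prune_dir (T : finType) (g : mixed_graph T) (A : {set T})
    (D : rel T) : rel T :=
  fun u v => [&& dir g u v, u \in A, v \in A & D u v].

Definition prune_bid (T : finType) (g : mixed_graph T) (A : {set T}) : rel T :=
  fun u v => [&& bid g u v, u \in A & v \in A].

Lemma prune_dir_vert (T : finType) (g : mixed_graph T) (A : {set T}) D u v :
  prune_dir g A D u v -> (u \in vert g :&: A) && (v \in vert g :&: A).
Proof. by case/and4P=> /dir_vert/andP[ug vg] uA vA _; rewrite !inE ug vg uA. Qed.

Lemma prune_bid_vert (T : finType) (g : mixed_graph T) (A : {set T}) u v :
  prune_bid g A u v -> (u \in vert g :&: A) && (v \in vert g :&: A).
Proof. by case/and3P=> /bid_vert/andP[ug vg] uA vA; rewrite !inE ug vg uA. Qed.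

Lemma prune_bid_sym (T : finType) (g : mixed_graph T) (A : {set T}) :
  symmetric (prune_bid g A).
Proof. by move=> u v; rewrite /prune_bid bid_sym; congr andb; rewrite andbC. Qed.

Definition prune (T : finType) (g : mixed_graph T) (A : {set T}) (D : rel T) :=
  MixedGraph (@prune_dir_vert T g A D) (@prune_bid_vert T g A)
    (@prune_bid_sym T g A).

Lemma prune_subgraph (T : finType) (g : mixed_graph T) (A : {set T}) D :
  subgraph (prune g A D) g.
Proof. by split=> [|u v /and4P[]|u v /and3P[]] //; apply: subsetIl. Qed.

Definition induced (T : finType) (g : mixed_graph T) (A : {set T}) :=
  prune g A (fun _ _ => true).

Lemma induced_adjacent (T : finType) (g : mixed_graph T) (A : {set T}) u v :
  u \in A -> v \in A -> adjacent g u v -> adjacent (induced g A) u v.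
Proof.
move=> uA vA; rewrite /adjacent /= /prune_dir /prune_bid uA vA.
by rewrite !andbT.
Qed.

Definition remove_arrow (T : finType) (g : mixed_graph T) (v w : T) :=
  prune g setT (fun u u' => (u, u') != (v, w)).

Lemma remove_arrow_adjacent (T : finType) (g : mixed_graph T) v w u u' :
    (u, u') != (v, w) -> (u', u) != (v, w) -> adjacent g u u' ->
  adjacent (remove_arrow g v w) u u'.
Proof.
move=> n1 n2; rewrite /adjacent /= /prune_dir /prune_bid !in_setT n1 n2.
by rewrite !andbT.
Qed.

Lemma subgraph_trans (T : finType) (r s g : mixed_graph T) :
  subgraph r s -> subgraph s g -> subgraph r g.
Proof.
move=> [rv rd rb] [sv sd sb]; split; first exact: subset_trans sv.
  by move=> u v /rd/sd.
by move=> u v /rb/sb.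
Qed.

Lemma subgraph_admg (T : finType) (s g : mixed_graph T) :
  subgraph s g -> admg g -> admg s.
Proof.
case=> _ sd sb [acyc nd nb]; split.
- by move=> c sc; apply: acyc; apply: sub_cycle sc.
- by move=> v; apply/negP=> /sd; rewrite nd.
- by move=> v; apply/negP=> /sb; rewrite nb.
Qed.

(** Trimming creates no new root, so it preserves both conditions on roots. *)
Definition trims (T : finType) (s' s : mixed_graph T) : Prop :=
  subgraph s' s /\
  {in vert s', forall v w, dir s v w -> exists w', dir s' v w'}.

Lemma trims_Root (T : finType) (s' s : mixed_graph T) v :
  trims s' s -> v \in vert s' -> (v \in Root s') = (v \in Root s).
Proof.
case=> -[/subsetP sv sd _] keep vs'; rewrite !inE vs' sv //=.
apply/eqP/eqP=> /setP noch; apply/setP=> w; rewrite !inE; apply/negP.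
  by case/keep=> // w' vw'; have := noch w'; rewrite !inE vw'.
by move/sd=> vw; have := noch w; rewrite !inE vw.
Qed.

Definition bridges (T : finType) (X Y : {set T}) (s : mixed_graph T) : Prop :=
  exists x y, [/\ x \in vert s, x \in X, y \in vert s, y \in Y
    & connect (adjacent s) x y].

(** Here a path has to join X to Y, a condition that deletions can break; being
    connected as a whole will follow from minimality. *)
Definition candidate (T : finType) (G : mixed_graph T) (X Y Z : {set T})
    (s : mixed_graph T) : Prop :=
  [/\ subgraph s G, bridges X Y s, Root s \subset Z :|: X :|: Y
    & forall v, v \in vert s -> v \notin Root s -> v \notin Z].

Lemma trims_candidate (T : finType) (G s s' : mixed_graph T) (X Y Z : {set T}) :
    candidate G X Y Z s -> trims s' s -> bridges X Y s' ->
  candidate G X Y Z s'.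
Proof.
move=> [sG _ rootS nonroot] ts xy; have [ss _] := ts.
have sv v : v \in vert s' -> v \in vert s by case: ss => /subsetP sv _ _ /sv.
split=> //; first exact: subgraph_trans ss sG.
  apply/subsetP=> v vR; have vs' : v \in vert s' by case/setIdP: vR.
  by apply: (subsetP rootS); rewrite -(trims_Root ts).
by move=> v vs'; rewrite (trims_Root ts) //; apply: nonroot; apply: sv.
Qed.

(** * Irreducible candidates *)

Definition graph_size (T : finType) (g : mixed_graph T) : nat :=
  #|vert g| + #|[set e | dir g e.1 e.2]| + #|[set e | bid g e.1 e.2]|.

Lemma subgraph_size (T : finType) (s' s : mixed_graph T) :
  subgraph s' s -> graph_size s <= graph_size s' -> subgraph s s'.
Proof.
case=> sv sd sb.
have sD : [set e | dir s' e.1 e.2] \subset [set e | dir s e.1 e.2].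
  by apply/subsetP=> e; rewrite !inE => /sd.
have sB : [set e | bid s' e.1 e.2] \subset [set e | bid s e.1 e.2].
  by apply/subsetP=> e; rewrite !inE => /sb.
have := leqif_add (leqif_add (subset_leqif_cards sv) (subset_leqif_cards sD))
          (subset_leqif_cards sB).
rewrite -!/(graph_size _) => -[le eq] ge; move: eq; rewrite eqn_leq le ge /=.
case/esym/andP=> /andP[/eqP eV /eqP eD] /eqP eB; split.
- by rewrite eV.
- by move=> u v uv; move/setP/(_ (u, v)): eD; rewrite !inE /= uv.
- by move=> u v uv; move/setP/(_ (u, v)): eB; rewrite !inE /= uv.
Qed.

Lemma ex_least (A : Type) (P : A -> Prop) (m : A -> nat) :
  (exists a, P a) -> exists2 a, P a & forall b, P b -> m a <= m b.
Proof.
case=> a; have [n] := ubnP (m a); elim: n a => // n IHn a lean Pa.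
have [[b [Pb ltba]]|nob] := classic (exists b, P b /\ m b < m a).
  exact: IHn (leq_trans ltba lean) Pb.
exists a => // b Pb; rewrite leqNgt; apply/negP=> ltba.
by apply: nob; exists b.
Qed.

Definition irreducible (T : finType) (X Y : {set T}) (s : mixed_graph T) :=
  forall s', trims s' s -> bridges X Y s' -> subgraph s s'.

Lemma ex_irreducible (T : finType) (G : mixed_graph T) (X Y Z : {set T}) :
    (exists s, candidate G X Y Z s) ->
  exists2 s, candidate G X Y Z s & irreducible X Y s.
Proof.
move/(ex_least (@graph_size T)) => [s cs mins]; exists s => // s' ts xy.
apply: subgraph_size; first by case: ts.
by apply: mins; apply: trims_candidate ts xy.
Qed.

(** Keeping only the component of [x] is a trimming, as it contains the children
    of its vertices. *)
Lemma irreducible_connected (T : finType) (X Y : {set T}) (s : mixed_graph T)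
    x y v :
    irreducible X Y s -> x \in vert s -> x \in X -> y \in vert s -> y \in Y ->
    connect (adjacent s) x y -> v \in vert s ->
  connect (adjacent s) x v.
Proof.
move=> irr xs xX ys yY xy vs.
pose K := [set w | connect (adjacent s) x w].
suff [/subsetP/(_ v vs) + _ _] : subgraph s (induced s K).
  by rewrite !inE => /andP[].
apply: irr.
  split=> [|u]; first exact: prune_subgraph.
  rewrite /= !inE => /andP[_ xu] w uw; exists w.
  have aw : adjacent s u w by rewrite /adjacent uw.
  by rewrite /= /prune_dir uw !inE xu (connect_trans xu (connect1 aw)).
exists x, y; split=> //; first by rewrite !inE xs connect0.
  by rewrite !inE ys xy.
by apply: (connect_within _ xy) => u w xu xw; apply: induced_adjacent;
  rewrite inE.
Qed.

(** [a] is the vertex from which a route from [x] enters [v], as provided by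
    [connect_last_step]. *)
Definition approaches (T : finType) (s : mixed_graph T) (v x a : T) : Prop :=
  (a = v /\ x = v) \/
  [/\ adjacent s a v, a != v & connect (avoiding v (adjacent s)) x a].

Lemma approaches_remove_arrow (T : finType) (s : mixed_graph T) v x a w :
    approaches s v x a -> (a = v \/ adjacent (remove_arrow s v w) a v) ->
  connect (adjacent (remove_arrow s v w)) x v.
Proof.
move=> [[_ -> //]|[_ anv xa]] [av|av]; first by rewrite av eqxx in anv.
apply: connect_trans (connect1 av); apply: connect_sub xa => u u'.
case/and3P=> uu' uv u'v; apply: connect1; apply: remove_arrow_adjacent => //.
  by rewrite xpair_eqE (negPf uv).
by rewrite xpair_eqE (negPf u'v).
Qed.

(** Deleting one of several arrows that leave [v] is a trimming, so it has to
    cut [v] off from [x] or from [y]. *)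
Lemma irreducible_arrow (T : finType) (X Y : {set T}) (s : mixed_graph T)
    x y v w :
    irreducible X Y s -> x \in vert s -> x \in X -> y \in vert s -> y \in Y ->
    1 < #|children s v| -> dir s v w ->
    connect (adjacent (remove_arrow s v w)) x v ->
  ~ connect (adjacent (remove_arrow s v w)) y v.
Proof.
move=> irr xs xX ys yY; rewrite (cardsD1 w) inE => + vw; rewrite vw ltnS.
case/card_gt0P=> w'; rewrite !inE => /andP[w'w vw'] xv yv.
suff [_ /(_ v w vw) + _] : subgraph s (remove_arrow s v w).
  by rewrite /= /prune_dir eqxx !andbF.
apply: irr.
  split=> [|u _ z uz]; first exact: prune_subgraph.
  have [->|uv] := eqVneq u v; [exists w' | exists z].
    by rewrite /= /prune_dir vw' !in_setT xpair_eqE (negPf w'w) andbF.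
  by rewrite /= /prune_dir uz !in_setT xpair_eqE (negPf uv).
exists x, y; split=> //; first by rewrite !inE xs.
  by rewrite !inE ys.
by apply: connect_trans xv _; rewrite connect_adjacent_sym.
Qed.

(** The children of [v] are the vertices [a] and [b] through which [x] and [y]
    reach it, and whatever does not hang on these two routes can be deleted. *)
Lemma irreducible_fork (T : finType) (X Y : {set T}) (s : mixed_graph T) v :
    admg s -> irreducible X Y s -> bridges X Y s -> v \in vert s ->
    1 < #|children s v| ->
  #|children s v| = 2 /\ forall u, ~~ dir s u v /\ ~~ bid s u v.
Proof.
move=> ag irr [x [y [xs xX ys yY xy]]] vs ch2; have [_ nd nb] := ag.
have crit w := irreducible_arrow (w := w) irr xs xX ys yY ch2.
have xv := irreducible_connected irr xs xX ys yY xy vs.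
have yv : connect (adjacent s) y v.
  by apply: connect_trans xv; rewrite connect_adjacent_sym.
have [a xa] : exists a, approaches s v x a := connect_last_step xv.
have [b yb] : exists b, approaches s v y b := connect_last_step yv.
have detour w z c : dir s v w -> approaches s v z c -> c != w ->
    connect (adjacent (remove_arrow s v w)) z v.
  move=> vw zc cw; have wv : w != v by apply: contraTneq vw => ->; rewrite nd.
  apply: (approaches_remove_arrow zc).
  case: zc => [[-> _]|[cv cnv _]]; [by left | right].
  apply: remove_arrow_adjacent => //.
    by rewrite xpair_eqE (negPf cnv).
  by rewrite xpair_eqE (negPf cw) andbF.
have sub : children s v \subset [set a; b].
  apply/subsetP=> w; rewrite !inE => vw; apply/norP=> -[wa wb].
  by case: (crit w vw); [apply: (detour w x a) | apply: (detour w y b)];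
    rewrite // eq_sym.
have /eqP chE : children s v == [set a; b].
  rewrite eqEcard sub; apply: leq_trans ch2.
  by rewrite cards2; case: (a != b).
move: ch2; rewrite chE cards2; case: eqVneq => // ab _; split=> // u.
have va : dir s v a by have := set21 a b; rewrite -chE inE.
have vb : dir s v b by have := set22 a b; rewrite -chE inE.
suff no_arrow : ~~ (dir s u v || bid s u v) by apply/andP; rewrite -negb_or.
apply/negP=> uv.
have unv : u != v.
  by apply: contraTneq uv => ->; rewrite nd nb.
have adju w : adjacent (remove_arrow s v w) u v.
  rewrite /adjacent /= /prune_dir /prune_bid !in_setT xpair_eqE (negPf unv) /=.
  by rewrite !andbT; case/orP: uv => ->; rewrite ?orbT.
have adjuv : adjacent s u v.
  by rewrite /adjacent; case/orP: uv => ->; rewrite ?orbT.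
(* What is left of [s] when the parts that hang on [v] but contain neither [x]
   nor [y] are deleted; the neighbour [u] has to be in it. *)
pose K := v |: [set w | connect (avoiding v (adjacent s)) x w
                     || connect (avoiding v (adjacent s)) y w].
have xaK : connect (avoiding v (adjacent s)) x a.
  by case: xa => [[av]|[]//]; rewrite av nd in va.
have ybK : connect (avoiding v (adjacent s)) y b.
  by case: yb => [[bv]|[]//]; rewrite bv nd in vb.
have sK : subgraph s (induced s K).
  have vK : v \in K by rewrite setU11.
  apply: irr.
    split=> [|z]; first exact: prune_subgraph.
    rewrite /= inE => /andP[_ zK] c zc.
    have [zv|znv] := eqVneq z v.
      by exists a; rewrite /= /prune_dir zv va vK !inE xaK orbT.
    exists c; rewrite /= /prune_dir zc zK andbT /=.
    have [-> //|cnv] := eqVneq c v.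
    have step : avoiding v (adjacent s) z c.
      by apply/and3P; split=> //; rewrite /adjacent zc.
    move: zK; rewrite !inE (negPf znv) (negPf cnv) /=.
    by case/orP=> zr; rewrite (connect_trans zr (connect1 step)) ?orbT.
  have toK z c : connect (avoiding v (adjacent s)) z c -> dir s v c ->
      (forall w, connect (avoiding v (adjacent s)) z w -> w \in K) ->
      connect (adjacent (induced s K)) z v.
    move=> zc vc zK; apply: (connect_trans (y := c)).
      apply: (connect_within _ zc) => p q zp zq /and3P[pq _ _].
      by apply: induced_adjacent => //; apply: zK.
    apply: connect1; apply: induced_adjacent => //; first exact: zK.
    by rewrite /adjacent vc orbT.
  have xK w : connect (avoiding v (adjacent s)) x w -> w \in K.
    by rewrite !inE => ->; rewrite orbT.
  have yK w : connect (avoiding v (adjacent s)) y w -> w \in K.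
    by rewrite !inE => ->; rewrite !orbT.
  exists x, y; split=> //; first by rewrite in_setI xs xK.
    by rewrite in_setI ys yK.
  apply: connect_trans (toK _ _ xaK va xK) _.
  by rewrite connect_adjacent_sym; exact: toK ybK vb yK.
have us : u \in vert s by case/andP: (adjacent_vert adjuv).
case: sK => /subsetP/(_ u us) + _ _; rewrite !inE (negPf unv) us /=.
(* Entering [v] through [u] makes the arrow to [a], or to [b], superfluous. *)
case/orP=> ur.
  case: (crit a va); last by apply: (detour a y b); rewrite // eq_sym.
  by apply: (approaches_remove_arrow (a := u)) => //; right.
case: (crit b vb); first exact: (detour b x a).
by apply: (approaches_remove_arrow (a := u)) => //; right.
Qed.

Lemma irreducible_structure (T : finType) (X Y : {set T}) (s : mixed_graph T) :
  admg s -> irreducible X Y s -> bridges X Y s -> structure_of_interest s.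
Proof.
move=> ag irr br; split=> //; last first.
  move=> v vs; case: (leqP #|children s v| 1) => [|ch2]; first by left.
  by right; apply: irreducible_fork irr br vs ch2.
have [x [y [xs xX ys yY xy]]] := br.
rewrite -(n_comp_connect (connect_adjacent_sym s) x).
apply: eq_n_comp_r => v; rewrite [in RHS]inE; apply/idP/idP.
  exact: irreducible_connected irr xs xX ys yY xy.
by move=> xv; rewrite -(closed_connect (@adjacent_closed T s) xv).
Qed.

(** * From an active path to a candidate *)

(** Removing the arrows that leave Z turns the vertices of Z into roots; it
    creates no root outside X and Y other than these, because an ancestor outside
    the three sets keeps its first arrow towards them. *)
Definition ancestral (T : finType) (G : mixed_graph T) (X Y Z : {set T}) :=
  prune G (ancestors G (Z :|: X :|: Y)) (fun u _ => u \notin Z).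

(** Membership in [A] spreads along an arrow from its head to its tail, hence
    backwards along forward steps and forwards along backward steps. So a vertex
    entered by an arrowhead gets it from the next vertex or, as a collider, from
    activity; any other vertex gets it from the previous one, which is the
    hypothesis on [b]. *)
Lemma active_connect (T : finType) (G : mixed_graph T) (X Y Z : {set T})
    (b : bool) v p (s := ancestral G X Y Z)
    (A := ancestors G (Z :|: X :|: Y)) :
    walk G v p -> active_from G Z b v p ->
    last v (unzip2 p) \in Z :|: X :|: Y -> (~~ b -> v \in A) ->
  v \in A /\ connect (adjacent s) v (last v (unzip2 p)).
Proof.
elim: p b v => [|[k w] p IHp] b v /=.
  by move=> _ _ lS _; split; [apply: mem_ancestors | apply: connect0].
case/andP=> vw wp /andP[vZ wact] lS bv.
have ZA : v \in ancestors G Z -> v \in A.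
  case/ancestorsP=> z zZ vz; apply: ancestors_connect vz _.
  by apply: mem_ancestors; rewrite !inE zZ.
have vA_head : head_at_source k -> v \in A.
  by move=> hk; move: vZ; rewrite hk andbT; case: (b) bv => // bv _; apply: bv.
have wA : ~~ head_at_target k -> w \in A.
  by case: k vw vA_head {wact vZ} => //= wv /(_ isT) vA _;
    apply: ancestors_connect vA; apply: connect1.
have [wA' wl] := IHp _ _ wp wact lS wA.
have vA : v \in A.
  case: k vw vA_head {vZ wact wA} => //= [vw _|_ -> //|_ -> //].
  by apply: ancestors_connect wA'; apply: connect1.
split=> //; apply: connect_trans wl; apply: connect1.
rewrite /adjacent /= /prune_dir /prune_bid vA wA' !andTb !andbT.
case: k vw vZ wact {vA_head wA} => /= vw; rewrite vw ?andbF ?orbT //.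
  by move=> ->.
by move=> _ /active_from_notin ->; rewrite orbT.
Qed.

Lemma active_candidate (T : finType) (G : mixed_graph T) (X Y Z : {set T}) x p :
    X \subset vert G -> Y \subset vert G -> x \in X ->
    last x (unzip2 p) \in Y -> walk G x p -> active_from G Z false x p ->
  candidate G X Y Z (ancestral G X Y Z).
Proof.
move=> /subsetP XG /subsetP YG xX lY wp ap; set s := ancestral G X Y Z.
set S := Z :|: X :|: Y.
have xA : x \in ancestors G S by apply: mem_ancestors; rewrite !inE xX orbT.
have lS : last x (unzip2 p) \in S by rewrite !inE lY orbT.
have [_ xl] := active_connect wp ap lS (fun _ => xA).
split; first exact: prune_subgraph.
- exists x, (last x (unzip2 p)); split=> //.
    by rewrite [_ \in _]in_setI XG.
  by rewrite [_ \in _]in_setI YG //; apply: mem_ancestors.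
- apply/subsetP=> v /setIdP[/setIP[vG vA]] /eqP/setP ch0.
  apply/negPn/negP=> vS; have /ancestorsP[w wS /connectP[[|u q] /=]] := vA.
    by move=> _ wv; rewrite -wv wS in vS.
  case/andP=> vu uq lq; have := ch0 u; rewrite !inE /= /prune_dir vu vA /=.
  have uA : u \in ancestors G S.
    by apply/ancestorsP; exists w => //; apply/connectP; exists q.
  have vZ : v \notin Z by apply: contra vS; rewrite !inE => ->.
  by rewrite -/S uA vZ.
- move=> v vs; rewrite inE vs /= => /set0Pn[w]; rewrite inE.
  by case/and4P.
Qed.

Theorem theorem1 (T : finType) (G : mixed_graph T) (X Y Z : {set T})
    (hG : admg G)
    (hX : X \subset vert G) (hY : Y \subset vert G) (hZ : Z \subset vert G)
    (hXY : [disjoint X & Y]) (hXZ : [disjoint X & Z])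
    (hYZ : [disjoint Y & Z]) :
  ~ d_separated G X Y Z <->
  exists s : mixed_graph T,
    structure_of_interest s /\ connects_under s G X Y Z.
Proof.
split=> [notsep|].
  have [s [sG br rootS nonroot] irr] : exists2 s, candidate G X Y Z s &
      irreducible X Y s.
    apply: ex_irreducible; apply: NNPP => nocand; apply: notsep.
    move=> x p xX lY /and3P[_ wp _] /active_pathP ap; apply: nocand.
    by exists (ancestral G X Y Z); apply: active_candidate ap.
  exists s; split.
    exact: irreducible_structure (subgraph_admg sG hG) irr br.
  have [x [y [xs xX ys yY _]]] := br.
  by split=> //; split; [exists x | exists y].
case=> s [[ag ncomp _] [sG [[x xs xX] [y ys yY]] rootS nonroot]] sep.
have xy := n_comp1_connect ncomp xs ys.
have [x0 [p [x0X lY up wp /active_pathP ap]]] := active_path_of_structure ag sG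
  hXZ hYZ rootS (nonroot_notin nonroot) xX yY xy.
by apply: (sep _ _ x0X lY _ ap); rewrite /is_path up (walk_sub sG wp) (subsetP hX).
Qed.
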